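(* Let $k$ and $r$ be integers with $1 \leq r \leq k-2$. Then \[\chi\big(K^2(2k+r,k)\big) \leq 2\left(\frac{9}{4}k + \frac{9(r+3)}{8}\right)^r.\]
   Context: For integers $n \geq 2k \ge 2$, the Kneser graph $K(n,k)$ has as vertices the $k$-element subsets of an $n$-element set, two vertices being adjacent iff they are disjoint. For a graph $G$, the square $G^2$ has vertex set $V(G)$, with two distinct vertices adjacent iff their distance in $G$ is at most 2. $K^2(n,k)$ denotes the square of $K(n,k)$, and $\chi$ denotes the chromatic number. *)

(* Defs.v *)
From mathcomp Require Import all_boot all_order all_algebra.
Set Implicit Arguments. Unset Strict Implicit. Unset Printing Implicit Defensive.

Record sgraph := SGraph {
  vertex :> finType;
  adj : rel vertex;
  adj_sym : symmetric adj;
  adj_irrefl : irreflexive adj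
}.

Section Graph.
Variable G : sgraph.

(* The distance (infinite between different components) is at most d iff some
   walk with at most d edges joins x to y; the tuple p lists the vertices of
   that walk after x. *)
Definition dist_le (d : nat) (x y : G) : bool :=
  [exists m : 'I_d.+1, exists p : m.-tuple G,
     path (@adj G) x p && (last x p == y)].

Lemma dist_leP d (x y : G) :
  reflect (exists p : seq G, [/\ size p <= d, path (@adj G) x p & last x p = y])
          (dist_le d x y).
Proof.
apply: (iffP existsP) => [[m /existsP[p /andP[xp /eqP py]]]|[p [pd xp py]]].
  by exists p; rewrite size_tuple -ltnS ltn_ord.
have pd' : size p < d.+1 by [].
exists (Ordinal pd'); apply/existsP; exists (in_tuple p).
by rewrite xp py eqxx.
Qed.

Lemma dist_le_sym d : symmetric (dist_le d).
Proof.
suff W x y : dist_le d x y -> dist_le d y x.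
  by move=> x y; apply/idP/idP; apply: W.
case/dist_leP=> p [pd xp <-]; apply/dist_leP; exists (rev (belast x p)).
rewrite size_rev size_belast rev_path; split=> //.
  by rewrite (eq_path (e' := @adj G)) // => u v; rewrite adj_sym.
by case: p {pd xp} => //= z p; rewrite rev_cons last_rcons.
Qed.

Definition sq_adj (x y : G) : bool := (x != y) && dist_le 2 x y.

Lemma sq_adj_sym : symmetric sq_adj.
Proof. by move=> x y; rewrite /sq_adj eq_sym dist_le_sym. Qed.

Lemma sq_adj_irrefl : irreflexive sq_adj.
Proof. by move=> x; rewrite /sq_adj eqxx. Qed.

Definition square : sgraph := SGraph sq_adj_sym sq_adj_irrefl.

Definition proper_coloring (m : nat) (f : {ffun G -> 'I_m}) : bool :=
  [forall x, forall y, adj x y ==> (f x != f y)].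

Definition colorable (m : nat) : bool :=
  [exists f : {ffun G -> 'I_m}, proper_coloring f].

Lemma colorable_ex : exists m, colorable m.
Proof.
exists #|G|; apply/existsP; exists [ffun x => enum_rank x].
apply/forallP=> x; apply/forallP=> y; apply/implyP; rewrite !ffunE.
by apply: contraTN => /eqP/enum_rank_inj->; rewrite adj_irrefl.
Qed.

Definition chromatic_number : nat := ex_minn colorable_ex.

End Graph.

Section Kneser.
Variables n k : nat.

Definition ksubset := {A : {set 'I_n} | #|A| == k}.

(* For k >= 1 disjoint vertices are automatically distinct; the first conjunct
   only removes the loop at the empty set when k = 0. *)
Definition kneser_adj (A B : ksubset) : bool :=
  (A != B) && [disjoint val A & val B].

Lemma kneser_adj_sym : symmetric kneser_adj.
Proof. by move=> A B; rewrite /kneser_adj eq_sym disjoint_sym. Qed.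

Lemma kneser_adj_irrefl : irreflexive kneser_adj.
Proof. by move=> A; rewrite /kneser_adj eqxx. Qed.

Definition kneser : sgraph := SGraph kneser_adj_sym kneser_adj_irrefl.

End Kneser.

(* Main.v *)
(* Let n = 2k + r and let F be a finite field with q >= n elements, the ground
   set being embedded in F. Two k-sets A, B at distance at most 2 are disjoint or
   meet in at least k - r points. Colour A by the r coefficients following the
   leading one in the polynomial with root set A: if A and B agree there, the
   difference of their polynomials has degree < k - r, so |A :&: B| >= k - r
   forces A = B. All k-sets disjoint from A pairwise meet in at least k - r
   points, hence at most one of them has the colour of A; so inside a colour
   class disjointness is a matching, and one more bit separates disjoint sets.
   This gives the bound 2 q^r.

   It remains to find a prime power q with n <= q <= 9(n + 3)/8. For n up to
   9 * 10^6 a table of primes suffices. For larger n we use Chebyshev's method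
   with integers c_t, t | 5040, such that sum_t c_t / t = 0 and
   S(m) = sum_t c_t floor(m / t) is nonpositive unless m = 8 mod 5040. If no prime
   power q satisfies floor(9n / q) = 8, i.e. n < q <= 9n/8, then by Legendre's
   formula prod_t floor(9n / t)!^c_t is at most a small power of lcm(1, ..., 9n/5040),
   whereas it grows like C^n for a larger constant C. *)

From Stdlib Require Import NArith.
Require Import Defs.
From mathcomp Require Import all_boot all_order all_algebra all_field zify lra.
Set Implicit Arguments. Unset Strict Implicit. Unset Printing Implicit Defensive.
Import Order.TTheory GRing.Theory Num.Theory.

(** * Colouring by coefficients *)

Lemma chromatic_number_leq_card (G : sgraph) (C : finType) (f : G -> C) :
  (forall x y, adj x y -> f x != f y) -> chromatic_number G <= #|C|.
Proof.
move=> f_proper; rewrite /chromatic_number; case: ex_minnP => m _; apply.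
apply/existsP; exists [ffun x => enum_rank (f x)].
apply/forallP=> x; apply/forallP=> y; apply/implyP=> xy.
by rewrite !ffunE (inj_eq enum_rank_inj) f_proper.
Qed.

Section RootPolynomial.
Variables (n : nat) (F : finFieldType) (h : 'I_n -> F).
Hypothesis h_inj : injective h.
Local Open Scope ring_scope.

Definition root_poly (A : {set 'I_n}) : {poly F} := \prod_(a in A) ('X - (h a)%:P).

Lemma size_root_poly A : size (root_poly A) = #|A|.+1.
Proof. by rewrite /root_poly -big_enum size_prod_XsubC -cardE. Qed.

Lemma root_poly_monic A : root_poly A \is monic.
Proof. by rewrite /root_poly -big_enum monic_prod_XsubC. Qed.

Lemma root_root_poly A a : root (root_poly A) (h a) = (a \in A).
Proof.
rewrite /root_poly -big_enum -(big_map h xpredT (fun x => 'X - x%:P)) root_prod_XsubC.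
by rewrite mem_map // mem_enum.
Qed.

(* The polynomials agree in degrees at least k - r, so their difference, having
   degree less than k - r but vanishing on A :&: B, is zero. *)
Lemma root_poly_top_coef_inj k r (A B : {set 'I_n}) : #|A| = k -> #|B| = k ->
    (k <= #|A :&: B| + r)%N ->
    (forall i, (k - r <= i < k)%N -> (root_poly A)`_i = (root_poly B)`_i) ->
  A = B.
Proof.
move=> cA cB cAB coefAB.
suff E : root_poly A = root_poly B.
  by apply/setP=> a; rewrite -!root_root_poly E.
apply/eqP; rewrite -subr_eq0; apply/negPn/negP => nz.
have sz : (size (root_poly A - root_poly B)%R <= k - r)%N.
  apply/leq_sizeP => i kri; rewrite coefB.
  have [ik|ki] := ltnP i k; first by rewrite coefAB ?kri ?subrr.
  move: ki; rewrite leq_eqVlt => /predU1P[<-|ki].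
    have lead (D : {set 'I_n}) : #|D| = k -> (root_poly D)`_k = 1.
      by move=> cD; have /monicP := root_poly_monic D; rewrite /lead_coef size_root_poly cD.
    by rewrite !lead ?subrr.
  by rewrite !nth_default ?subrr // size_root_poly ?cA ?cB.
have := @max_poly_roots _ _ [seq h a | a in A :&: B] nz.
rewrite map_inj_uniq ?enum_uniq // size_map -cardE.
suff -> : all (root (root_poly A - root_poly B)) [seq h a | a in A :&: B].
  by move=> /(_ isT isT) H; have := leq_trans H sz; rewrite ltnNge leq_subLR addnC cAB.
apply/allP => x /mapP[a]; rewrite mem_enum inE => /andP[aA aB] ->.
rewrite -!root_root_poly !rootE in aA aB *.
by rewrite hornerD hornerN (eqP aA) (eqP aB) subrr.
Qed.

End RootPolynomial.

Section SquareKneser.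
Variables (k r : nat) (F : finFieldType).
Let n := 2 * k + r.
Hypothesis nF : n <= #|F|.

Let h (i : 'I_n) : F := enum_val (widen_ord nF i).

Let h_inj : injective h.
Proof. by move=> i j /enum_val_inj /(congr1 val) /= /val_inj. Qed.

Local Notation V := (kneser n k).

(** For [r <= k] these are, up to sign, the first r elementary symmetric functions of the field
    elements labelling A. *)
Definition syndrome (A : V) : {ffun 'I_r -> F} :=
  [ffun i : 'I_r => ((root_poly h (val A))`_(k - i.+1))%R].

(** The union of A and B avoids C, so it has at most n - k = k + r points, while |A| + |B| = 2k. *)
Lemma common_neighbor_inter (A B C : V) :
  [disjoint val A & val C] -> [disjoint val B & val C] ->
  k <= #|val A :&: val B| + r.
Proof.
move=> dA dB.
have := cardsUI (val A) (val B); rewrite (eqP (valP A)) (eqP (valP B)).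
have : #|(val A :|: val B) :|: val C| <= n.
  by rewrite -[X in _ <= X]card_ord max_card.
rewrite cardsU (disjoint_setI0 _) ?cards0 ?(eqP (valP C)) ?subn0; first by rewrite /n; lia.
rewrite -setI_eq0 setIUl; move: dA dB; rewrite -!setI_eq0 => /eqP-> /eqP->.
by rewrite setU0.
Qed.

Lemma syndrome_inj (A B : V) :
  k <= #|val A :&: val B| + r -> syndrome A = syndrome B -> A = B.
Proof.
move=> cAB /ffunP sAB; apply/val_inj.
apply: (root_poly_top_coef_inj h_inj (eqP (valP A)) (eqP (valP B)) cAB) => i ki.
have kir : k - i.+1 < r by lia.
have := sAB (Ordinal kir); rewrite !ffunE /=.
by have -> : k - (k - i.+1).+1 = i by lia.
Qed.

Definition partner (A B : V) : bool :=
  [disjoint val A & val B] && (syndrome A == syndrome B).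

Lemma partner_sym : symmetric partner.
Proof. by move=> A B; rewrite /partner disjoint_sym eq_sym. Qed.

Lemma partner_uniq A B C : partner A B -> partner A C -> B = C.
Proof.
move=> /andP[dB /eqP sB] /andP[dC /eqP sC].
apply: syndrome_inj; last by rewrite -sB.
by apply: (common_neighbor_inter (C := A)); rewrite disjoint_sym.
Qed.

(** The bit records whether A precedes its partner in the enumeration of vertices; it is false if
    there is no partner. *)
Definition sq_color (A : V) : bool * {ffun 'I_r -> F} :=
  ([exists B, partner A B && (enum_rank A < enum_rank B)], syndrome A).

Lemma sq_color_proper (A B : square V) : adj A B -> sq_color A != sq_color B.
Proof.
case/andP=> nAB /dist_leP[p []]; case: p => [|C [|D [|//]]] _ /=.
- by move=> _ E; rewrite E eqxx in nAB.
- rewrite andbT => /andP[_ dAC] E; subst C.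
  apply/eqP => -[bAB sAB].
  have pAB : partner A B by rewrite /partner dAC sAB eqxx.
  (* Since partners are unique, the existential is decided by the given one. *)
  have bit C D : partner C D ->
      [exists E, partner C E && (enum_rank C < enum_rank E)] = (enum_rank C < enum_rank D).
    move=> pCD; apply/existsP/idP => [[E /andP[pCE]]|CD].
      by rewrite (partner_uniq pCD pCE).
    by exists D; rewrite pCD.
  move: bAB; rewrite (bit _ _ pAB) (bit B A) ?[partner B A]partner_sym //.
  case: (ltngtP (enum_rank A) (enum_rank B)) => // /val_inj /enum_rank_inj E.
  by rewrite E eqxx in nAB.
(* Walk of length two: C is a common neighbour, so the syndrome alone separates A and B. *)
move=> /and3P[/andP[_ dAC] /andP[_ dCD] _] E; subst D.
apply: contraNneq nAB => -[_ sAB]; apply/eqP; apply: syndrome_inj sAB.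
by apply: (common_neighbor_inter dAC); rewrite disjoint_sym.
Qed.

Lemma chromatic_square_kneser_leq : chromatic_number (square V) <= 2 * #|F| ^ r.
Proof.
apply: leq_trans (chromatic_number_leq_card sq_color_proper) _.
by rewrite card_prod card_bool card_ffun card_ord.
Qed.

End SquareKneser.

(** * Factorial ratios without prime powers in a window *)

(** Legendre's formula with a free upper limit, so that different factorials can be compared term by
    term. *)
Lemma logn_fact_trunc p n N : prime p -> n <= N ->
  logn p n`! = \sum_(1 <= k < N.+1) n %/ p ^ k.
Proof.
move=> pp leN; rewrite logn_fact // [RHS](big_cat_nat (n := n.+1)) //=.
rewrite [X in _ = _ + X]big_nat_cond [X in _ = _ + X]big1 ?addn0 // => k /andP[/andP[nk _] _].
by rewrite divn_small // (leq_trans nk) // ltnW // ltn_expl ?prime_gt1.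
Qed.

Lemma dvdn_from_logn m n : 0 < m ->
  (forall p, prime p -> logn p m <= logn p n) -> m %| n.
Proof.
case: (posnP n) => [-> //|n0] m0 le_log; apply/dvdn_partP=> // p.
rewrite mem_primes => /and3P[pp _ _].
by rewrite p_part pfactor_dvdn ?le_log.
Qed.

Lemma bin_leq_exp2 n m : 'C(n, m) <= 2 ^ n.
Proof.
elim: n m => [|n IH] [|m] //; first by rewrite bin0 expn_gt0.
by rewrite binS expnS mul2n -addnn leq_add.
Qed.

(* [G] plays the part of lcm(1, ..., n): it is assembled from the binomial
   coefficients 'C(n, uphalf n), each of which is divisible by a factor p for
   every power of p between [uphalf n] and [n]. *)
Lemma prime_power_multiple n : exists G,
  [/\ 0 < G, G <= 8 ^ n & forall p N, prime p ->
       \sum_(1 <= k < N.+1) (p ^ k <= n) <= logn p G].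
Proof.
suff [G [G0 Gn Gp]] : exists G,
  [/\ 0 < G, G <= 2 ^ (3 * n.-1) & forall p N, prime p ->
       \sum_(1 <= k < N.+1) (p ^ k <= n) <= logn p G].
  exists G; split=> //; apply: leq_trans Gn _.
  by rewrite -(expnM 2 3) leq_exp2l // leq_mul2l leq_pred orbT.
elim/ltn_ind: n => n IH.
have [n1|n1] := leqP n 1.
  exists 1; split=> // [|p N pp]; first by rewrite expn_gt0.
  rewrite big_nat_cond big1 // => k /andP[/andP[k0 _] _].
  apply/eqP; rewrite eqb0 -ltnNge (leq_ltn_trans n1) //.
  by rewrite -(expn0 p) ltn_exp2l ?prime_gt1.
set m := uphalf n.
have mn : m < n by rewrite /m; lia.
have [G [G0 Gn Gp]] := IH m mn.
exists (G * 'C(n, m)); split=> [||p N pp].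
- by rewrite muln_gt0 G0 bin_gt0 ltnW.
- apply: (leq_trans (leq_mul Gn (bin_leq_exp2 n m))).
  by rewrite -expnD leq_exp2l //; move: n1; rewrite /m; lia.
have mn' := ltnW mn.
rewrite lognM ?bin_gt0 //.
pose M := maxn n N.
apply: (@leq_trans (\sum_(1 <= k < M.+1) (p ^ k <= n))).
  rewrite [X in _ <= X](big_cat_nat (n := N.+1)) //= ?leq_addr //.
  by rewrite ltnS leq_maxr.
have := congr1 (logn p) (bin_fact mn').
rewrite !lognM ?muln_gt0 ?fact_gt0 ?bin_gt0 ?mn' //.
rewrite !(@logn_fact_trunc p _ M) //; try by rewrite leq_max; lia.
move=> E; have {}Gp := Gp p M pp.
suff H: \sum_(1 <= k < M.+1) (p ^ k <= n) + \sum_(1 <= k < M.+1) m %/ p ^ k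
  + \sum_(1 <= k < M.+1) (n - m) %/ p ^ k <= 
  \sum_(1 <= k < M.+1) (p ^ k <= m) + \sum_(1 <= k < M.+1) n %/ p ^ k by lia.
rewrite -!big_split /=; apply: leq_sum => k _.
have d0 : 0 < p ^ k by rewrite expn_gt0 prime_gt0.
have Em := divn_eq m (p ^ k); have Enm := divn_eq (n - m) (p ^ k).
have En : n = (m %/ p ^ k + (n - m) %/ p ^ k) * p ^ k + (m %% p ^ k + (n - m) %% p ^ k).
  by rewrite mulnDl; lia.
have le1 : m %/ p ^ k + (n - m) %/ p ^ k <= n %/ p ^ k.
  by rewrite {2}En divnMDl // leq_addr.
(* If p ^ k <= m, floors are superadditive. Otherwise n - m <= m < p ^ k kills both floors on the
   left, and n %/ p ^ k >= 1 once p ^ k <= n. *)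
case: (leqP (p ^ k) m) => [km|km].
  by rewrite (leq_trans km mn') -addnA leq_add2l.
rewrite (divn_small km) (@divn_small (n - m)); last by rewrite /m in km *; lia.
by rewrite !addn0 add0n; case: (leqP (p ^ k) n) => //= kn; rewrite divn_gt0.
Qed.

(** * Elementary bounds for factorials of multiples *)

Lemma leq_pow2r m n e : m <= n -> m ^ e <= n ^ e.
Proof. by case: e => // e le_mn; rewrite leq_exp2r. Qed.

Lemma fact_addn_lb n a : n`! * n ^ a <= (n + a)`!.
Proof.
elim: a => [|a IH]; first by rewrite muln1 addn0.
rewrite addnS factS expnSr mulnA mulnC leq_mul //.
by rewrite -addnS leq_addr.
Qed.

Lemma fact_addn_ub n a : (n + a)`! <= n`! * (n + a) ^ a.
Proof.
elim: a => [|a IH]; first by rewrite muln1 addn0.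
rewrite addnS factS expnS mulnCA leq_mul2l /=.
apply: (leq_trans IH); rewrite leq_mul2l; apply/orP; right.
exact: leq_pow2r.
Qed.

Lemma fact_muln_ub a z : (a * z)`! <= a ^ (a * z) * z`! ^ a.
Proof.
elim: z => [|z IH]; first by rewrite muln0 exp1n.
rewrite mulnS addnC; apply: (leq_trans (fact_addn_ub _ _)).
apply: (leq_trans (leq_mul IH (leqnn _))).
by rewrite addnC -mulnS expnMn factS expnMn mulnS expnD; lia.
Qed.

(** The a new factors of each step are only bounded below by a z instead of a (z + 1); the factor (a
    z) ^ a carried along pays for this shift. *)
Lemma fact_muln_lb a z : 0 < z -> a ^ (a * z) * z`! ^ a <= (a * z)`! * (a * z) ^ a.
Proof.
case: z => // z _; elim: z => [|z IH].
  by rewrite !muln1 exp1n muln1 leq_pmull ?fact_gt0.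
have {}IH := leq_trans IH (fact_addn_lb (a * z.+1) a).
rewrite -mulnSr in IH.
rewrite factS expnMn [a * z.+2]mulnSr expnD -mulnSr.
apply: leq_trans (leq_mul IH (leqnn ((a * z.+2) ^ a))).
by rewrite [in X in _ <= X]expnMn; lia.
Qed.

(** A pair is (t, |c_t|); to stay in [nat], positive and negative c_t go into separate lists. *)
Definition floor_sum (s : seq (nat * nat)) m := \sum_(x <- s) x.2 * (m %/ x.1).

Definition fact_prod (s : seq (nat * nat)) X := \prod_(x <- s) (X %/ x.1)`! ^ x.2.

(* Up to a factor polynomial in z, [fact_prod s (L * z)] is
   [growth L s ^ z * z`! ^ floor_sum s L]. *)
Definition growth L (s : seq (nat * nat)) :=
  \prod_(x <- s) (L %/ x.1) ^ ((L %/ x.1) * x.2).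

Lemma fact_prod_gt0 s X : 0 < fact_prod s X.
Proof. by rewrite prodn_gt0 // => x; rewrite expn_gt0 fact_gt0. Qed.

Lemma growth_gt0 L s : 0 < growth L s.
Proof. by rewrite prodn_gt0 // => x; case: (L %/ x.1) => // a; rewrite expn_gt0. Qed.

Lemma logn_prod_seq (I : Type) (s : seq I) (E : I -> nat) p :
  (forall i, 0 < E i) -> logn p (\prod_(i <- s) E i) = \sum_(i <- s) logn p (E i).
Proof.
move=> E0; elim: s => [|i s IH]; first by rewrite !big_nil logn1.
by rewrite !big_cons lognM ?IH // prodn_gt0.
Qed.

Lemma logn_fact_prod p s X : prime p ->
  logn p (fact_prod s X) = \sum_(1 <= k < X.+1) floor_sum s (X %/ p ^ k).
Proof.
move=> pp; rewrite logn_prod_seq => [|x]; last by rewrite expn_gt0 fact_gt0.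
rewrite exchange_big /=; apply: eq_bigr => x _.
rewrite lognX (@logn_fact_trunc _ _ X) ?leq_div //= big_distrr /=.
by apply: eq_bigr => k _; rewrite divnAC.
Qed.

Section Certificate.
Variables (L w e : nat) (s1 s2 : seq (nat * nat)).
Hypothesis L0 : 0 < L.
Hypothesis s1_dvd : all (fun x => x.1 %| L) s1.
Hypothesis s2_dvd : all (fun x => x.1 %| L) s2.
Hypothesis balanced : floor_sum s1 L = floor_sum s2 L.
Hypothesis le_away : forall v, v < L -> v != w -> floor_sum s1 v <= floor_sum s2 v.
Hypothesis le_at : floor_sum s1 w <= floor_sum s2 w + e.

(** With [balanced], the linear parts for [s1] and [s2] cancel, so the difference of their floor
    sums has period L. *)
Lemma floor_sum_periodic s u v : all (fun x => x.1 %| L) s ->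
  floor_sum s (u * L + v) = u * floor_sum s L + floor_sum s v.
Proof.
move=> sL; rewrite /floor_sum big_distrr -big_split /=.
elim: s sL => [|x s IH] /=; first by rewrite !big_nil.
case/andP=> xL /IH {}IH; rewrite !big_cons IH; congr (_ + _).
have x0 : 0 < x.1 by apply: dvdn_gt0 xL.
by rewrite divnDl ?dvdn_mull // -muln_divA // mulnDr mulnCA.
Qed.

(** Compare exponents of p by Legendre. A term can be positive only if X %/ p ^ k is w mod L; as the
    value w is excluded, then p ^ k <= X %/ L, and G ^ e supplies the missing e. *)
Lemma fact_prod_leq X : (forall p k, prime p -> 0 < k -> X %/ p ^ k != w) ->
  fact_prod s1 X <= fact_prod s2 X * 8 ^ (e * (X %/ L)).
Proof.
move=> no_pp; have [G [G0 G8 Gp]] := prime_power_multiple (X %/ L).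
apply: (@leq_trans (fact_prod s2 X * G ^ e)); last first.
  by rewrite leq_mul2l mulnC expnM leq_pow2r ?orbT.
apply: dvdn_leq; first by rewrite muln_gt0 fact_prod_gt0 expn_gt0 G0.
apply: dvdn_from_logn => [|p pp]; first exact: fact_prod_gt0.
rewrite lognM ?fact_prod_gt0 ?expn_gt0 ?G0 // lognX !logn_fact_prod //.
apply: leq_trans (leq_add (leqnn _) (leq_mul (leqnn e) (Gp p X pp))).
rewrite big_distrr -big_split /= !big_nat; apply: leq_sum => k /andP[k0 _].
have pk0 : 0 < p ^ k by rewrite expn_gt0 prime_gt0.
have := no_pp p k pp k0; set m := X %/ p ^ k => mw.
have [mL|Lm] := ltnP m L; first by rewrite (leq_trans (le_away mL mw)) ?leq_addr.
have -> : p ^ k <= X %/ L by rewrite leq_divRL // mulnC -leq_divRL.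
rewrite muln1 (divn_eq m L) !floor_sum_periodic // balanced -addnA leq_add2l.
have [->//|vw] := eqVneq (m %% L) w.
by rewrite (leq_trans (le_away _ vw)) ?leq_addr // ltn_mod.
Qed.

Lemma growth_lb s X : all (fun x => x.1 %| L) s -> 0 < X %/ L ->
  growth L s ^ (X %/ L) * (X %/ L)`! ^ floor_sum s L
    <= fact_prod s X * growth L s * (X %/ L) ^ floor_sum s L.
Proof.
set z := X %/ L => sL z0; rewrite /growth /fact_prod /floor_sum.
elim: s sL => [|x s IH] /=; first by rewrite !big_nil exp1n.
case/andP=> xL /IH {}IH; rewrite !big_cons.
have x0 : 0 < x.1 by apply: dvdn_gt0 xL.
set a := L %/ x.1.
have azX : a * z <= X %/ x.1.
  by rewrite leq_divRL // mulnAC divnK // mulnC leq_trunc_div.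
have H : (a ^ (a * x.2)) ^ z * z`! ^ (x.2 * a)
    <= (X %/ x.1)`! ^ x.2 * (a ^ (a * x.2) * z ^ (x.2 * a)).
  have -> : (a ^ (a * x.2)) ^ z * z`! ^ (x.2 * a) = (a ^ (a * z) * z`! ^ a) ^ x.2.
    by rewrite expnMn -!expnM; congr (_ ^ _ * _ ^ _); lia.
  have -> : (X %/ x.1)`! ^ x.2 * (a ^ (a * x.2) * z ^ (x.2 * a)) =
      ((X %/ x.1)`! * (a * z) ^ a) ^ x.2.
    by rewrite !expnMn -!expnM [x.2 * a]mulnC.
  apply: leq_pow2r; apply: leq_trans (fact_muln_lb a z0) _.
  by rewrite leq_mul2r leq_fact ?orbT.
rewrite expnMn !expnD.
have := leq_mul H IH; set u := (_ ^ z); set v := (_ ^ z).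
by rewrite !mulnA; congr (_ <= _); lia.
Qed.

Lemma growth_ub s X : all (fun x => x.1 %| L) s ->
  fact_prod s X <= growth L s ^ (X %/ L).+1 * (X %/ L).+1`! ^ floor_sum s L.
Proof.
set z := (X %/ L).+1 => sL; rewrite /growth /fact_prod /floor_sum.
elim: s sL => [|x s IH] /=; first by rewrite !big_nil exp1n.
case/andP=> xL /IH {}IH; rewrite !big_cons.
have x0 : 0 < x.1 by apply: dvdn_gt0 xL.
set a := L %/ x.1.
have azX : X %/ x.1 <= a * z.
  rewrite -(mulnK (a * z) x0) leq_div2r // mulnAC divnK // mulnC ltnW //.
  by rewrite ltn_ceil.
have H : (X %/ x.1)`! ^ x.2 <= (a ^ (a * x.2)) ^ z * z`! ^ (x.2 * a).
  have -> : (a ^ (a * x.2)) ^ z * z`! ^ (x.2 * a) = (a ^ (a * z) * z`! ^ a) ^ x.2.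
    by rewrite expnMn -!expnM; congr (_ ^ _ * _ ^ _); lia.
  by apply: leq_pow2r; apply: leq_trans (fact_muln_ub a z); rewrite leq_fact.
rewrite expnMn expnD mulnACA; exact: leq_mul.
Qed.

(** Put z = X %/ L, so L z <= X < L (z + 1). By [balanced] the powers of z! on both sides cancel, up
    to factors polynomial in z. *)
Lemma growth_leq X : 0 < X %/ L ->
    (forall p k, prime p -> 0 < k -> X %/ p ^ k != w) ->
  growth L s1 ^ (X %/ L) <= growth L s2 ^ (X %/ L) * (growth L s1 * growth L s2)
    * ((X %/ L) * (X %/ L).+1) ^ floor_sum s1 L * 8 ^ (e * (X %/ L)).
Proof.
move=> z0 no_pp; have lb := growth_lb s1_dvd z0; have ub := growth_ub X s2_dvd.
have le12 := fact_prod_leq no_pp; rewrite -balanced in ub.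
move: lb ub le12; set z := X %/ L in z0 *; set D := floor_sum s1 L.
set g1 := growth L s1; set g2 := growth L s2 => lb ub le12.
have f0 : 0 < z`! ^ D by rewrite expn_gt0 fact_gt0.
rewrite -(leq_pmul2r f0); apply: leq_trans lb _.
apply: (leq_trans (leq_mul (leq_mul le12 (leqnn g1)) (leqnn (z ^ D)))).
apply: (leq_trans (leq_mul (leq_mul (leq_mul ub (leqnn _)) (leqnn g1)) (leqnn (z ^ D)))).
rewrite factS !expnMn expnS.
set x1 := g2 ^ z; set x2 := z.+1 ^ D; set x3 := z`! ^ D; set x4 := 8 ^ _; set x5 := z ^ D.
by rewrite leq_eqVlt; apply/orP; left; apply/eqP; lia.
Qed.

End Certificate.

(** * Prime powers between n and 9(n + 3)/8 *)

Definition natpairs (s : seq (N * N)) := [seq (N.to_nat x.1, N.to_nat x.2) | x <- s].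

Definition floor_sumN (s : seq (N * N)) (m : N) : N :=
  foldr (fun x acc => x.2 * (m / x.1) + acc)%num 0%num s.

Lemma to_nat_div a b : N.to_nat (a / b) = N.to_nat a %/ N.to_nat b.
Proof.
case: (N.eq_dec b 0) => [->|b0]; first by rewrite divn0; case: a.
have E := N.div_mod a b b0; have lt := N.mod_lt a b b0.
have -> : N.to_nat a = N.to_nat (a / b) * N.to_nat b + N.to_nat (a mod b) by nia.
by rewrite divnMDl ?divn_small ?addn0 //; lia.
Qed.

Lemma to_nat_leq a b : (a <=? b)%num -> N.to_nat a <= N.to_nat b.
Proof. by move/N.leb_spec0; lia. Qed.

Lemma to_nat_exp a b : N.to_nat (a ^ b) = N.to_nat a ^ N.to_nat b.
Proof.
rewrite -{1}(N2Nat.id b); elim: (N.to_nat b) => [|m IH]; first by rewrite N.pow_0_r.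
by rewrite Nat2N.inj_succ N.pow_succ_r' N2Nat.inj_mul IH expnS.
Qed.

Lemma floor_sumNE s m : floor_sum (natpairs s) (N.to_nat m) = N.to_nat (floor_sumN s m).
Proof.
rewrite /floor_sum big_map; elim: s => [|x s IH]; first by rewrite big_nil.
by rewrite big_cons IH /= -to_nat_div; lia.
Qed.

Fixpoint allN (f : N -> bool) (m : nat) (v : N) : bool :=
  if m is m'.+1 then f v && allN f m' (v + 1) else true.

Lemma allNP f m v : allN f m v -> forall i, i < m -> f (v + N.of_nat i)%num.
Proof.
elim: m v => // m IH v /= /andP[fv /IH {}IH] [_|i im]; first by rewrite N.add_0_r.
by have := IH i im; congr (is_true (f _)); lia.
Qed.

Fixpoint val_rec (fuel : nat) (b a : N) : N :=
  if fuel is fuel'.+1 then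
    if (a mod b =? 0)%num then N.succ (val_rec fuel' b (a / b)) else 0%num
  else 0%num.

(** [smoothN] checks the factorisations built from these valuations; ten rounds cover quotients up
    to 630 < 2 ^ 10. *)
Definition valN := val_rec 10.

Definition smoothN (L : N) (s : seq (N * N)) : bool :=
  all (fun x => (L / x.1 =? 2 ^ valN 2 (L / x.1) * 3 ^ valN 3 (L / x.1)
                         * 5 ^ valN 5 (L / x.1) * 7 ^ valN 7 (L / x.1))%num) s.

Definition val_sumN (L b : N) (s : seq (N * N)) : N :=
  foldr (fun x acc => valN b (L / x.1) * (L / x.1 * x.2) + acc)%num 0%num s.

Lemma growth_smooth L s : smoothN L s -> growth (N.to_nat L) (natpairs s) =
  2 ^ N.to_nat (val_sumN L 2 s) * 3 ^ N.to_nat (val_sumN L 3 s)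
    * 5 ^ N.to_nat (val_sumN L 5 s) * 7 ^ N.to_nat (val_sumN L 7 s).
Proof.
rewrite /growth big_map; elim: s => [|x s IH] /=; first by rewrite big_nil.
case/andP=> /N.eqb_spec E /IH {}IH; rewrite big_cons {}IH /= -to_nat_div.
have stepE v a c acc : N.to_nat (v * (a * c) + acc)
    = N.to_nat v * (N.to_nat a * N.to_nat c) + N.to_nat acc by lia.
have mulE a b : N.to_nat (a * b) = N.to_nat a * N.to_nat b by lia.
have aE : N.to_nat (L / x.1) = 2 ^ N.to_nat (valN 2 (L / x.1))
    * 3 ^ N.to_nat (valN 3 (L / x.1)) * 5 ^ N.to_nat (valN 5 (L / x.1))
    * 7 ^ N.to_nat (valN 7 (L / x.1)).
  move: E; move: (valN 2 _) (valN 3 _) (valN 5 _) (valN 7 _) => v2 v3 v5 v7 ->.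
  by rewrite !mulE !to_nat_exp.
rewrite (stepE (valN 2 _)) (stepE (valN 3 _)) (stepE (valN 5 _)) (stepE (valN 7 _)) {1}aE.
move: (valN 2 _) (valN 3 _) (valN 5 _) (valN 7 _) {aE E} => v2 v3 v5 v7.
rewrite !expnMn -!expnM !expnD; set e := _ * N.to_nat x.2.
set x2 := 2 ^ (_ * e); set x3 := 3 ^ (_ * e); set x5 := 5 ^ (_ * e); set x7 := 7 ^ (_ * e).
by rewrite mulnACA; congr (_ * _); rewrite mulnACA; congr (_ * _); rewrite mulnACA.
Qed.

Lemma growth_leq_exp2 L s b : all (fun x => L %/ x.1 <= 2 ^ b) s ->
  growth L s <= 2 ^ (b * floor_sum s L).
Proof.
rewrite /growth /floor_sum; elim: s => [|x s IH] /=; first by rewrite !big_nil expn_gt0.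
case/andP=> xb /IH {}IH; rewrite !big_cons mulnDr expnD; apply: leq_mul IH.
by rewrite (expnM 2) [x.2 * _]mulnC; apply: leq_pow2r.
Qed.

(* The pairs (t, |c_t|) with c_t > 0, resp. c_t < 0. The values were found by
   linear programming: among all choices with S(m) <= 0 for m <> 8 mod 5040 and
   S(8) bounded, they maximise the growth rate - sum_t c_t ln t / t. *)
Definition cert_pos : seq (N * N) :=
  [:: (8, 2); (18, 2); (28, 2); (45, 2); (48, 2); (63, 2); (80, 2); (112, 2);
      (120, 2); (168, 5); (280, 7); (360, 1); (420, 4); (630, 5); (1008, 4);
      (1260, 1); (1680, 7); (2520, 2); (5040, 4)]%num.

Definition cert_neg : seq (N * N) :=
  [:: (9, 2); (16, 2); (24, 2); (40, 2); (56, 4); (84, 2); (90, 2); (126, 2);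
      (140, 2); (144, 2); (180, 1); (240, 2); (315, 3); (336, 3); (504, 1);
      (560, 4); (840, 10)]%num.

Lemma cert_leq v : v < N.to_nat 5040 -> v != N.to_nat 8 ->
  floor_sum (natpairs cert_pos) v <= floor_sum (natpairs cert_neg) v.
Proof.
have /allNP check : allN (fun v => (v =? 8)%num ||
    (floor_sumN cert_pos v <=? floor_sumN cert_neg v)%num) (N.to_nat 5040) 0.
  by vm_cast_no_check (erefl true).
move=> vL v8; have /orP[/N.eqb_spec E|/to_nat_leq] := check v vL.
  by move: v8; rewrite -E Nat2N.id eqxx.
by rewrite -!floor_sumNE Nat2N.id.
Qed.

(** Take logarithms to base 2, replacing log z by the linear bound 13 + z %/ 2 ^ 13, whose small
    slope suffices against the gain of 17 - 6 bits per unit of z. *)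
Lemma growth_exponent_leq g1 g2 z B D : 0 < g2 -> 2 ^ 17 * g2 <= g1 ->
    g1 * g2 <= 2 ^ B ->
    g1 ^ z <= g2 ^ z * (g1 * g2) * (z * z.+1) ^ D * 8 ^ (2 * z) ->
  17 * z <= B + 2 * (13 + z %/ 2 ^ 13) * D + 6 * z.
Proof.
move=> g20 g12 gB le.
set b := 13 + z %/ 2 ^ 13.
have zb : z < 2 ^ b.
  apply: (@leq_trans ((z %/ 2 ^ 13).+1 * 2 ^ 13)); first by rewrite ltn_ceil ?expn_gt0.
  by rewrite /b addnC expnD leq_mul2r ltn_expl ?orbT.
move: b zb => b zb.
rewrite -(leq_exp2l _ _ (ltnSn 1)) -(@leq_pmul2l (g2 ^ z)) ?expn_gt0 ?g20 //.
have -> : g2 ^ z * 2 ^ (17 * z) = (2 ^ 17 * g2) ^ z by rewrite expnMn mulnC -expnM.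
apply: (leq_trans (leq_pow2r z g12)); apply: (leq_trans le).
have -> : 8 ^ (2 * z) = 2 ^ (6 * z) by rewrite (expnM 2 6) (expnM 8).
rewrite 2!(expnD 2) -!mulnA leq_mul // !mulnA leq_mul // leq_mul // (expnM 2).
apply: leq_pow2r; rewrite mul2n -addnn expnD leq_mul // ltnW //.
Qed.

(* Common prime powers are cancelled so that only numbers of about 1700 bits
   have to be compared in [cert_growth]. *)
Lemma leq_smooth a2 a3 a5 a7 b2 b3 b5 b7 d2 d3 d5 d7 :
    b2 = a2 + d2 -> a3 = b3 + d3 -> b5 = a5 + d5 -> b7 = a7 + d7 ->
    2 ^ 17 * (2 ^ d2 * 5 ^ d5 * 7 ^ d7) <= 3 ^ d3 ->
  2 ^ 17 * (2 ^ b2 * 3 ^ b3 * 5 ^ b5 * 7 ^ b7) <= 2 ^ a2 * 3 ^ a3 * 5 ^ a5 * 7 ^ a7.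
Proof.
move=> -> -> -> ->; rewrite !expnD.
move: (2 ^ 17) (2 ^ a2) (2 ^ d2) (3 ^ b3) (3 ^ d3) (5 ^ a5) (5 ^ d5) (7 ^ a7) (7 ^ d7).
move=> c x2 y2 x3 y3 x5 y5 x7 y7 /(leq_mul (leqnn (x2 * x3 * x5 * x7))).
by congr (_ <= _); lia.
Qed.

Lemma cert_growth : 2 ^ 17 * growth (N.to_nat 5040) (natpairs cert_neg)
  <= growth (N.to_nat 5040) (natpairs cert_pos).
Proof.
rewrite !growth_smooth; [|by vm_cast_no_check (erefl true)..].
(* The differences of the exponents of 2, 3, 5, 7; only that of 3 favours [cert_pos]. *)
apply: (@leq_smooth _ _ _ _ _ _ _ _
  (N.to_nat 992) (N.to_nat 1050) (N.to_nat 45) (N.to_nat 196));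
  try by rewrite -plusE -N2Nat.inj_add; congr N.to_nat; vm_compute.
have /to_nat_leq : (2 ^ 17 * (2 ^ 992 * 5 ^ 45 * 7 ^ 196) <=? 3 ^ 1050)%num.
  by vm_cast_no_check (erefl true).
by rewrite !N2Nat.inj_mul !multE !to_nat_exp.
Qed.

Lemma prime_power_large n : N.to_nat 9000000 <= n ->
  exists p k, [/\ prime p, 0 < k, n < p ^ k & 8 * p ^ k <= 9 * n].
Proof.
move=> n8; pose good p k := [&& prime p, 0 < k, n < p ^ k & 8 * p ^ k <= 9 * n].
(* The bounded search is decidable and loses nothing, as p and k are at most p ^ k <= 9n/8. *)
have [/existsP[p /existsP[k /and4P[*]]]|no] :=
  boolP [exists p : 'I_(9 * n).+1, exists k : 'I_(9 * n).+1, good p k].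
  by exists p, k.
have no_pp p k : prime p -> 0 < k -> (9 * n) %/ p ^ k != N.to_nat 8.
  move=> pp k0; apply: contra no => /eqP E.
  have p0 : 0 < p ^ k by rewrite expn_gt0 prime_gt0.
  have lb : 8 * p ^ k <= 9 * n by rewrite -leq_divRL // E.
  have ub : 9 * n < 9 * p ^ k by rewrite -ltn_divLR // E.
  have pk : p <= p ^ k by have := leq_pexp2l (prime_gt0 pp) k0; rewrite expn1.
  have kp : k < p ^ k by apply: ltn_expl; apply: prime_gt1.
  have pn : p < (9 * n).+1 by lia.
  have kn : k < (9 * n).+1 by lia.
  apply/existsP; exists (Ordinal pn); apply/existsP; exists (Ordinal kn).
  by rewrite /good /= pp k0 lb andbT -(ltn_pmul2l (isT : 0 < 9)).
have bal : floor_sum (natpairs cert_pos) (N.to_nat 5040)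
         = floor_sum (natpairs cert_neg) (N.to_nat 5040).
  by rewrite !floor_sumNE; congr N.to_nat; vm_compute.
have at8 : floor_sum (natpairs cert_pos) (N.to_nat 8)
        <= floor_sum (natpairs cert_neg) (N.to_nat 8) + 2.
  by rewrite !floor_sumNE; vm_compute.
have L0 : 0 < N.to_nat 5040 by lia.
have d1 : all (fun x => x.1 %| N.to_nat 5040) (natpairs cert_pos).
  by rewrite all_map; vm_compute.
have d2 : all (fun x => x.1 %| N.to_nat 5040) (natpairs cert_neg).
  by rewrite all_map; vm_compute.
set z := (9 * n) %/ N.to_nat 5040.
have zlb : N.to_nat 16071 <= z by rewrite /z (leq_divRL _ _ L0); clear -n8; lia.
have z0 : 0 < z by clear -zlb; lia.
have := growth_leq L0 d1 d2 bal cert_leq at8 z0 no_pp.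
rewrite -/z => le.
have b1 : growth (N.to_nat 5040) (natpairs cert_pos)
    <= 2 ^ (10 * floor_sum (natpairs cert_pos) (N.to_nat 5040)).
  by apply: growth_leq_exp2; rewrite all_map; vm_compute.
have b2 : growth (N.to_nat 5040) (natpairs cert_neg)
    <= 2 ^ (10 * floor_sum (natpairs cert_neg) (N.to_nat 5040)).
  by apply: growth_leq_exp2; rewrite all_map; vm_compute.
have := leq_mul b1 b2; rewrite -expnD => b12.
have := growth_exponent_leq (growth_gt0 _ _) cert_growth b12 le.
rewrite -bal floor_sumNE.
have -> : floor_sumN cert_pos 5040 = 3505%num by vm_compute.
(* With D = 3505 and B = 20 D this reads 11 z <= 161230 + 7010 (z %/ 2 ^ 13), which fails from z =
   16071 on. *)
have := leq_trunc_div z (2 ^ 13).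
by clear -zlb; lia.
Qed.

(** * Trial division and the table of primes *)

Fixpoint no_divisor (fuel : nat) (d p : N) : bool :=
  if (p <? d * d)%num then true else
  if fuel is fuel'.+1 then
    ~~ (p mod d =? 0)%num && no_divisor fuel' (d + 1) p
  else false.

Lemma no_divisorP fuel d p : no_divisor fuel d p ->
  forall e, N.to_nat d <= e -> e ^ 2 <= N.to_nat p -> ~~ (e %| N.to_nat p).
Proof.
have small c e : (p < c * c)%num -> N.to_nat c <= e -> e ^ 2 <= N.to_nat p ->
    ~~ (e %| N.to_nat p) by nia.
elim: fuel d => [|fuel IH] d /=; case: N.ltb_spec0 => //.
- by move=> pd _ e; apply: small.
- by move=> pd _ e; apply: small.
move=> _ /andP[pd /IH {}IH] e; rewrite leq_eqVlt => /predU1P[<- _|de]; last by apply: IH; lia.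
apply: contra pd => /dvdnP[q E]; apply/N.eqb_spec.
have -> : p = (N.of_nat q * d)%num by lia.
exact: N.Div0.mod_mul.
Qed.

Definition prime_table : seq N :=
  [::
   11; 13; 19; 23; 29; 37; 43; 47; 53; 61; 73; 83; 97; 113; 131; 151; 173;
   199; 227; 257; 293; 331; 373; 421; 467; 523; 587; 661; 743; 839; 947; 1069;
   1201; 1327; 1493; 1669; 1879; 2113; 2381; 2683; 3019; 3391; 3803; 4273;
   4801; 5399; 6073; 6833; 7691; 8647; 9721; 10939; 12301; 13841; 15569;
   17519; 19709; 22171; 24943; 28057; 31567; 35509; 39937; 44927; 50543;
   56857; 63949; 71947; 80933; 91033; 102409; 115211; 129607; 145807; 164023;
   184523; 207589; 233509; 262697; 295517; 332461; 374009; 420757; 473353;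
   532523; 599087; 673961; 758203; 852959; 959579; 1079527; 1214471; 1366279;
   1537061; 1729193; 1945337; 2188493; 2462041; 2769791; 3116011; 3505501;
   3943691; 4436647; 4991201; 5615101; 6316969; 7106591; 7994897; 8994233;
   10118503]%num.

Lemma prime_table_prime p : p \in prime_table -> prime (N.to_nat p).
Proof.
(* 3300 rounds pass the square root of the largest entry, about 3181. *)
have /allP H : all (fun p => (1 <? p)%num && no_divisor 3300 2 p) prime_table.
  by vm_cast_no_check (erefl true).
case/H/andP=> /N.ltb_spec0 p1 /no_divisorP nd; apply/negPn/negP => /primePns[|[d [pd dp]]].
  lia.
by apply/negP; apply: nd => //; apply: prime_gt1.
Qed.

(** The worst n served by q is p + 1, for which n + 3 = p + 4. *)
Definition small_gap (p q : N) : bool := (8 * q <=? 9 * (p + 4))%num.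

Lemma prime_table_gap n : 7 <= n -> n <= N.to_nat 9000000 ->
  exists p, [/\ prime p, n <= p & 8 * p <= 9 * (n + 3)].
Proof.
move=> n7 n8.
(* The chain starts from the dummy entry 6, so that the first prime 11 serves every n from 7 on. *)
have gap : path small_gap 6%num prime_table.
  by vm_cast_no_check (erefl true).
have : n <= N.to_nat (last 6%num prime_table).
  by apply: leq_trans n8 _; rewrite /=; lia.
have := prime_table_prime; have : N.to_nat 6 < n by lia.
elim: prime_table (6%num) gap => [|q s IH] p /= => [_|/andP[/N.leb_spec0 pq qs] pn tp]; first lia.
have [nq _|qn] := leqP n (N.to_nat q).
  by exists (N.to_nat q); split=> //; [apply: tp; rewrite mem_head | lia].
by apply: IH qs qn _ => x xs; apply: tp; rewrite inE xs orbT.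
Qed.

Lemma finite_field_between n : 7 <= n ->
  exists F : finFieldType, n <= #|F| /\ 8 * #|F| <= 9 * (n + 3).
Proof.
move=> n7; have [n9|n9] := leqP n (N.to_nat 9000000).
  have [p [pp np pn]] := prime_table_gap n7 n9.
  have [F _ cF] := pPrimePowerField pp (ltn0Sn 0).
  by exists F; rewrite cF expn1.
have [p [k [pp k0 nq qn]]] := prime_power_large (ltnW n9).
have [F _ cF] := pPrimePowerField pp k0.
exists F; rewrite cF (ltnW nq) (leq_trans qn) //.
by rewrite leq_mul2l leq_addr orbT.
Qed.

Local Open Scope ring_scope.

Lemma natr_color_bound (R : realFieldType) (c q k r : nat) :
    (c <= 2 * q ^ r)%N -> (8 * q <= 9 * (2 * k + r + 3))%N ->
  c%:R <= 2 * (9 / 4 * k%:R + 9 * (r%:R + 3) / 8) ^+ r :> R.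
Proof.
rewrite -(ler_nat R) => /le_trans le_c le_q; apply: le_c.
have {}le_q : q%:R <= 9 / 4 * k%:R + 9 * (r%:R + 3) / 8 :> R.
  by move: le_q; rewrite -(ler_nat R) !(natrM, natrD); lra.
rewrite natrM natrX ler_pM2l ?ltr0n // lerXn2r // nnegrE ?ler0n //.
exact: le_trans (ler0n _ _) le_q.
Qed.

Theorem theorem1 (k r : nat) (hr : (1 <= r)%N) (hrk : (r + 2 <= k)%N) :
  (chromatic_number (square (kneser (2 * k + r) k)))%:R
    <= 2 * (9 / 4 * k%:R + 9 * (r%:R + 3) / 8) ^+ r :> rat.
Proof.
have n7 : (7 <= 2 * k + r)%N by lia.
have [F [nF Fn]] := finite_field_between n7.
exact: natr_color_bound (chromatic_square_kneser_leq nF) Fn.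
Qed.
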